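(* Let $R$ be a weakly Laskerian ring and $I$ a proper ideal of $R$. Then the set $\operatorname{Min} I$ of minimal prime ideals of $I$ is finite.
   Context: All rings are commutative with identity. For an $R$-module $M$, $\operatorname{Ass}_R M$ denotes the set of associated primes of $M$, i.e. prime ideals $\mathfrak p$ of $R$ of the form $\mathfrak p=(0:_R x)$ for some $x\in M$. An $R$-module $M$ is weakly Laskerian if $\operatorname{Ass}_R(M/N)$ is a finite set for every submodule $N$ of $M$. A ring is weakly Laskerian if it is weakly Laskerian as a module over itself. For a proper ideal $I$, $\operatorname{Min} I$ denotes the set of prime ideals of $R$ that are minimal (under inclusion) among the prime ideals containing $I$. *)

(* Defs.v *)
From HB Require Import structures.
From mathcomp Require Import all_boot all_algebra.
From mathcomp Require Import generic_quotient ring_quotient.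
From mathcomp Require Import boolp classical_sets functions cardinality.

Set Implicit Arguments.
Unset Strict Implicit.
Unset Printing Implicit Defensive.

Import GRing.Theory.
Local Open Scope ring_scope.
Local Open Scope quotient_scope.
Local Open Scope classical_set_scope.

(* Ideals ([idealr], [prime_idealr]) and submodules ([submodClosed]) are
   boolean predicates; this is no restriction, because the axioms of [boolp]
   decide every [Prop]. An [idealr] is proper by definition, so the library
   defines it over a nontrivial ring only; a ring that has a proper ideal is
   nontrivial. *)

Section QuotientModule.
Variables (R : pzRingType) (M : lmodType R) (N : submodClosed M).

Definition submod_pred : {pred M} := [pred x : M | x \in N].

Lemma submod_zmod_closed : zmod_closed submod_pred.
Proof.
split=> [|x y]; rewrite !inE; first exact: rpred0.
by move=> xN yN; rewrite -scaleN1r; apply: rpredD => //; apply: rpredZ.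
Qed.

HB.instance Definition _ :=
  GRing.isZmodClosed.Build M submod_pred submod_zmod_closed.

Definition quotmod : Type := Quotient.quot submod_pred.
HB.instance Definition _ := GRing.Zmodule.on quotmod.

Definition quotmod_pi (x : M) : quotmod := \pi_(Quotient.quot submod_pred) x.

Definition quotmod_scale (a : R) (u : quotmod) : quotmod :=
  quotmod_pi (a *: repr (u : Quotient.quot submod_pred)).

Lemma quotmod_piP (x y : M) :
  (quotmod_pi x == quotmod_pi y) = (x - y \in N).
Proof. by rewrite -Quotient.idealrBE. Qed.

Lemma quotmod_piD (x y : M) :
  quotmod_pi (x + y) = quotmod_pi x + quotmod_pi y.
Proof. by rewrite /quotmod_pi; rewrite raddfD. Qed.

Lemma quotmod_reprK (u : quotmod) :
  quotmod_pi (repr (u : Quotient.quot submod_pred)) = u.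
Proof. exact: reprK. Qed.

Lemma quotmod_piZ a x : quotmod_pi (a *: x) = quotmod_scale a (quotmod_pi x).
Proof.
apply/eqP; rewrite quotmod_piP -scalerBr rpredZ // -quotmod_piP.
by rewrite quotmod_reprK.
Qed.

Lemma quotmod_scaleA a b u :
  quotmod_scale a (quotmod_scale b u) = quotmod_scale (a * b) u.
Proof. by rewrite -[u]quotmod_reprK -!quotmod_piZ scalerA. Qed.

Lemma quotmod_scale1 : left_id 1 quotmod_scale.
Proof. by move=> u; rewrite -[u]quotmod_reprK -quotmod_piZ scale1r. Qed.

Lemma quotmod_scaleDr : right_distributive quotmod_scale +%R.
Proof.
move=> a u v; rewrite -[u]quotmod_reprK -[v]quotmod_reprK.
by rewrite -quotmod_piD -!quotmod_piZ -quotmod_piD scalerDr.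
Qed.

Lemma quotmod_scaleDl u :
  {morph (fun a => quotmod_scale a u) : a b / a + b}.
Proof.
move=> a b /=; rewrite -[u]quotmod_reprK.
by rewrite -!quotmod_piZ -quotmod_piD scalerDl.
Qed.

HB.instance Definition _ := GRing.Zmodule_isLmodule.Build R quotmod
  quotmod_scaleA quotmod_scale1 quotmod_scaleDr quotmod_scaleDl.

End QuotientModule.

(* A prime ideal is determined by its elements, so finiteness of a set of
   [prime_idealr] is finiteness of a set of subsets of the ring. *)
Lemma prime_idealr_inj (R : nzRingType) (p q : prime_idealr R) :
  (p : {pred R}) =i (q : {pred R}) -> p = q.
Proof.
case: p q => [p pc] [q qc] /= epq.
have {}epq : p = q by apply/funext => a; exact: epq.
case: q / epq in qc *; congr PrimeIdealr.Pack.
case: pc => [[p1] [p2] [p3] [p4]]; case: qc => [[q1] [q2] [q3] [q4]].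
by congr PrimeIdealr.Class; f_equal; exact: Prop_irrelevance.
Qed.

Definition Ass (R : comNzRingType) (M : lmodType R) : set (prime_idealr R) :=
  [set p : prime_idealr R |
    exists x : M, forall a : R, a \in p <-> a *: x = 0].

Definition weakly_Laskerian (R : comNzRingType) (M : lmodType R) : Prop :=
  forall N : submodClosed M, finite_set (Ass (quotmod N)).

Definition weakly_Laskerian_ring (R : comNzRingType) : Prop :=
  weakly_Laskerian R^o.

Definition Min (R : comNzRingType) (I : idealr R) : set (prime_idealr R) :=
  [set p : prime_idealr R | {subset I <= p} /\
    forall q : prime_idealr R, {subset I <= q} -> {subset q <= p} -> q = p].

(* Main.v *)
(** The minimal primes over [I] form a Hausdorff space: if [p] and [q] are
    distinct minimal primes, Krull's theorem applied to the multiplicative set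
    [(R \ p)(R \ q)] yields [u \notin q] and [v \notin p] with [u v \in I].
    An infinite space of this kind contains an infinite discrete subspace [B].
    If [J] is the intersection of the primes in [B] and [x] lies in every prime
    of [B] except [p], then [p = (J : x)] is associated to [R / J]; hence [R / J]
    has infinitely many associated primes. *)
Require Import Defs.
From HB Require Import structures.
From mathcomp Require Import all_boot all_algebra.
From mathcomp Require Import ring_quotient boolp classical_sets cardinality.

Import GRing.Theory.
Local Open Scope ring_scope.
Local Open Scope classical_set_scope.

(** Zorn's lemma yields an ideal that is maximal among those containing [I] and missing [S]. It is
    prime: enlarged by [u] or by [v] outside it, it meets [S], and the product of the two elements
    found would lie in both it and [S] if it contained [u * v]. *)
Lemma exists_prime_disjoint (R : comNzRingType) (I : idealr R) (S : set R) :
    S 1 -> (forall s t, S s -> S t -> S (s * t)) ->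
    (forall s, S s -> s \notin I) ->
  exists q : prime_idealr R, {subset I <= q} /\ forall s, S s -> s \notin q.
Proof.
move=> S1 SM SI.
(* The union of an empty chain is empty, so the ideal is [A `|` I], not [A]. *)
pose hull (A : set R) : set R := [set x | A x \/ x \in I].
pose P (A : set R) := (forall a u v, hull A u -> hull A v -> hull A (a * u + v))
  /\ forall s, S s -> ~ hull A s.
have [F FP Ftot|A [[AD AS] Amax]] := @Zorn_bigcup R P.
  split=> [a u v|s Ss [[X FX Xs]|sI]]; last 2 first.
  - by have [_ /(_ s Ss)] := FP _ FX; apply; left.
  - by move: (SI s Ss); rewrite sI.
  have lift X w : F X -> hull X w -> hull (\bigcup_(X in F) X) w.
    by move=> FX [Xw|wI]; [left; exists X|right].
  move=> [[X FX Xu]|uI] [[Y FY Yv]|vI].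
  - have [XY|YX] := Ftot _ _ FX FY.
      by apply: (lift Y) => //; apply: (FP _ FY).1; left=> //; apply: XY.
    by apply: (lift X) => //; apply: (FP _ FX).1; left=> //; apply: YX.
  - by apply: (lift X) => //; apply: (FP _ FX).1; [left|right].
  - by apply: (lift Y) => //; apply: (FP _ FY).1; [right|left].
  - by right; rewrite rpredD // idealMr.
have A0 : hull A 0 by right; apply: rpred0.
have AM a u : hull A u -> hull A (a * u).
  by move=> /(AD a u 0)/(_ A0); rewrite addr0.
have meets c : ~ hull A c -> exists2 m, hull A m & exists r, S (m + r * c).
  move=> Ac; apply: contrapT => nS.
  (* [B] is the ideal [hull A + R c]. It already contains [I], so [hull B] is [B]; if it missed [S],
     it would contradict the maximality of [A]. *)
  pose B : set R := [set x | exists2 m, hull A m & exists r, x = m + r * c].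
  have BI x : x \in I -> B x.
    by move=> xI; exists x; [right|exists 0; rewrite mul0r addr0].
  have hB x : hull B x -> B x by case=> // /BI.
  apply: (Amax B); first split.
  - by move=> x Ax; exists x; [left|exists 0; rewrite mul0r addr0].
  - move=> BA; apply: Ac; left; apply: BA; exists 0 => //.
    by exists 1; rewrite add0r mul1r.
  - split=> [a u v /hB[m Am [r ->]] /hB[n An [t ->]]|s Ss /hB[m Am [r se]]].
      left; exists (a * m + n); first exact: AD.
      by exists (a * r + t); rewrite mulrDr mulrDl mulrA addrACA.
    by apply: nS; exists m => //; exists r; rewrite -se.
pose Q : {pred R} := fun x => `[< hull A x >].
have QE x : (x \in Q) = `[< hull A x >] by [].
have Qideal : idealr_closed Q.
  split=> [||a u v]; rewrite !QE; first exact/asboolP.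
    by apply/asboolP; apply: AS.
  by move=> /asboolP Au /asboolP Av; apply/asboolP; apply: AD.
have Qprime : prime_idealr_closed Q.
  move=> u v; rewrite !QE => /asboolP Auv; apply: contrapT => /negP.
  rewrite negb_or => /andP[/asboolPn /meets[m Am [r Sr]]].
  move=> /asboolPn /meets[n An [t St]].
  apply: (AS _ (SM _ _ Sr St)).
  rewrite mulrDr; apply: (AD) => //; rewrite mulrDl [m * _]mulrC mulrACA.
  by apply: (AD) => //; apply: AM.
pose q : prime_idealr R := HB.pack_for (prime_idealr R) Q
  (isIdealr.Build R Q Qideal) (isPrimeIdealrClosed.Build R Q Qprime).
exists q; split=> [x xI|s Ss].
  by rewrite [_ \in _]QE; apply/asboolP; right.
by rewrite [_ \in _]QE; apply/asboolPn; apply: AS.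
Qed.

Lemma Min_separated (R : comNzRingType) (I : idealr R) (p q : prime_idealr R) :
    Min I p -> Min I q -> p <> q ->
  exists u v, [/\ u \notin q, v \notin p & u * v \in I].
Proof.
move=> [Ip pmin] [Iq qmin] neq_pq; apply: contrapT => nsep.
pose S : set R := [set s | exists u v, [/\ u \notin q, v \notin p & s = u * v]].
have [||s [u [v [uq vp ->]]]|r [Ir rS]] := @exists_prime_disjoint R I S.
- by exists 1, 1; rewrite !idealr1 mulr1.
- move=> _ _ [u [v [uq vp ->]]] [u' [v' [uq' vp' ->]]].
  exists (u * u'), (v * v'); rewrite !prime_idealrM !negb_or mulrACA.
  by split=> //; apply/andP.
- by apply/negP => uvI; apply: nsep; exists u, v.
(* Taking [u = 1] or [v = 1] shows that [S] contains the complements of both [p] and [q], so [r]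
   lies below both minimal primes and equals each. *)
- have rp : {subset r <= p}.
    move=> a ar; apply: contraLR ar => ap; apply: rS.
    by exists 1, a; rewrite idealr1 mul1r.
  have rq : {subset r <= q}.
    move=> a ar; apply: contraLR ar => aq; apply: rS.
    by exists a, 1; rewrite idealr1 mulr1.
  by apply: neq_pq; rewrite -(pmin r) // (qmin r).
Qed.

(** For empty [B] this is the whole ring, which is not an [idealr]; hence the view as a submodule of
    [R^o]. *)
Definition bigcap_primes (R : comNzRingType) (B : set (prime_idealr R)) :
  {pred R^o} := fun x => `[< forall p, B p -> (x : R) \in p >].

Lemma bigcap_primesP (R : comNzRingType) (B : set (prime_idealr R)) (x : R^o) :
  reflect (forall p, B p -> (x : R) \in p) (x \in bigcap_primes R B).
Proof. exact: asboolP. Qed.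

Lemma bigcap_primes_submod (R : comNzRingType) (B : set (prime_idealr R)) :
  submod_closed (bigcap_primes R B).
Proof.
split=> [|a u v /bigcap_primesP Bu /bigcap_primesP Bv].
  by apply/bigcap_primesP => p _; apply: rpred0.
by apply/bigcap_primesP => p Bp; rewrite rpredD ?idealMr ?Bu ?Bv.
Qed.

HB.instance Definition _ (R : comNzRingType) (B : set (prime_idealr R)) :=
  GRing.isSubmodClosed.Build R R^o (bigcap_primes R B)
    (GRing.submod_closed_semi (bigcap_primes_submod R B)).

Lemma discrete_primes_finite (R : comNzRingType) (B : set (prime_idealr R)) :
    weakly_Laskerian_ring R ->
    (forall p, B p ->
      exists2 x, x \notin p & forall q, B q -> q <> p -> x \in q) ->
  finite_set B.
Proof.
move=> hR Bdisc; apply: sub_finite_set (hR (bigcap_primes R B)) => p Bp.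
have [x xp xq] := Bdisc _ Bp.
exists (quotmod_pi (bigcap_primes R B) x) => a.
have -> : (a *: quotmod_pi (bigcap_primes R B) x = 0) <->
          a * x \in bigcap_primes R B.
  rewrite -[_ *: _]/(quotmod_scale a _) -quotmod_piZ.
  have -> : 0 = quotmod_pi (bigcap_primes R B) 0 by rewrite /quotmod_pi raddf0.
  have := quotmod_piP (bigcap_primes R B) (a *: (x : R^o)) 0.
  by rewrite subr0 => <-; split=> /eqP.
(* Primality of [p] cancels [x]. Conversely, [a * x] lies in [p] because of [a], and in the other
   primes of [B] because of [x]. *)
split=> [ap|/bigcap_primesP/(_ _ Bp)]; last first.
  by rewrite prime_idealrM (negPf xp) orbF.
apply/bigcap_primesP => q Bq; rewrite prime_idealrM.
have [->|/xq ->] := pselect (q = p); by rewrite ?ap ?orbT.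
Qed.

(** The second hypothesis says that [p] is not isolated in [Min I]. Points [q n] converging to [p]
    are chosen one by one, each separated from [p] before the next is taken. *)
Lemma discrete_seq_of_accumulation (R : comNzRingType) (I : idealr R)
    (p : prime_idealr R) :
    Min I p ->
    (forall w, w \notin p -> exists q, [/\ Min I q, q <> p & w \notin q]) ->
  exists (q : nat -> prime_idealr R) (x : nat -> R),
    forall n m, x n \in q m <-> n <> m.
Proof.
move=> Ip pacc.
(* With [u], [v] separating [q] from [p], [u * w] cuts out a neighbourhood of [q] and [v * w] a
   smaller one of [p]. The triple [(p, 0, 0)] is a dummy that makes the step total, as [choice]
   requires. *)
have step w : exists t : prime_idealr R * R * R, w \notin p ->
    let: (q, x, w') := t in
    [/\ Min I q, x \notin q, w' \notin p, x * w' \in I &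
        exists a b, x = a * w /\ w' = b * w].
  have [wp|wp] := boolP (w \in p); first by exists (p, 0, 0).
  have [q [Iq qp wq]] := pacc w wp.
  have [u [v [uq vp uvI]]] := Min_separated R I p q Ip Iq (nesym qp).
  exists (q, u * w, v * w) => _; split=> //.
  - by rewrite prime_idealrM negb_or uq.
  - by rewrite prime_idealrM negb_or vp.
  - by rewrite mulrACA mulrC idealMr.
  - by exists u, v.
(* The sets [w n \notin _] are shrinking basic neighbourhoods of [p]: [q n]
   lies in the [n]th but not in the next one, and [x n \notin _] is disjoint
   from the latter. *)
have [f fP] := choice step.
pose w n := iter n (fun w => (f w).2) 1.
pose q n := (f (w n)).1.1; pose x n := (f (w n)).1.2.
have wp n : w n \notin p.
  elim: n => [|n IH]; first by rewrite idealr1.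
  by have := fP _ IH; rewrite /= -/(w n); case: (f (w n)) => [[? ?] ?] /= [].
have wP n : [/\ Min I (q n), x n \notin q n, x n * w n.+1 \in I,
    exists a, x n = a * w n & exists b, w n.+1 = b * w n].
  have := fP _ (wp n); rewrite /q /x /= -/(w n).
  case: (f (w n)) => [[? ?] ?] /= [? ? _ ? [a [b [? ?]]]].
  by split=> //; [exists a|exists b].
have wdvd n k : exists b, w (n + k)%N = b * w n.
  elim: k => [|k [b bE]]; first by exists 1; rewrite addn0 mul1r.
  rewrite addnS; have [_ _ _ _ [c ->]] := wP (n + k)%N.
  by exists (c * b); rewrite bE mulrA.
have xdvd n m : (n < m)%N -> exists b, x m = b * w n.+1.
  move=> /subnKC <-; have [_ _ _ [a ->] _] := wP (n.+1 + (m - n.+1))%N.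
  have [b ->] := wdvd n.+1 (m - n.+1)%N.
  by exists (a * b); rewrite mulrA.
have wq n : w n.+1 \in q n.
  have [[Iq _] xq /Iq] := wP n.
  by rewrite prime_idealrM (negPf xq).
exists q, x => n m; split=> [xqm nm|/eqP].
  by move: xqm; have [_ + _] := wP m; rewrite nm => /negPf ->.
(* If [m < n], then [x n] is a multiple of [w m.+1], which lies in [q m]. If [n < m], then [q m]
   contains [x n * w n.+1] but not [w n.+1], a divisor of [x m]. *)
rewrite neq_ltn => /orP[nm|mn]; last first.
  by have [b ->] := xdvd _ _ mn; rewrite idealMr.
have [[Iq _] xqm _ _ _] := wP m; have [_ _ /Iq + _ _] := wP n.
rewrite prime_idealrM => /orP[//|wqm].
by have [b xE] := xdvd _ _ nm; move: xqm; rewrite xE idealMr.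
Qed.

Theorem theorem2p3 (R : comNzRingType) (hR : weakly_Laskerian_ring R)
  (I : idealr R) : finite_set (Min I).
Proof.
have [disc|] := pselect (forall p, Min I p ->
    exists2 x, x \notin p & forall q, Min I q -> q <> p -> x \in q).
  exact: discrete_primes_finite.
(* [Min I] is not discrete, so some [p] in it is an accumulation point. *)
move=> /existsNP[p /not_implyP[Ip nisol]].
have [w wp|q [x xq]] := discrete_seq_of_accumulation R I p Ip.
  apply: contrapT => nacc; apply: nisol; exists w => // q Iq qp.
  by apply: contrapT => /negP wq; apply: nacc; exists q.
have xnq n : x n \notin q n by apply/negP => /xq.
have q_inj : injective q.
  by move=> n m qnm; apply: contrapT => /xq; apply/negP; rewrite -qnm.
(* The elements [x n] make the range of [q] discrete, hence finite, against the injectivity of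
   [q]. *)
have rq_fin : finite_set (range q).
  apply: (discrete_primes_finite R) => // _ [n _ <-].
  exists (x n) => // _ [m _ <-] qmn; apply/xq => nm.
  exact: qmn (congr1 q (esym nm)).
case: infinite_nat; apply: sub_finite_set (finite_preimage _ rq_fin).
  by move=> n _; exists n.
by move=> n m _ _ /q_inj.
Qed.
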